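(* There exist absolute constants $c,C'>0$ and $\alpha\ge 0$ such that the following holds. For all integers $n\ge 2$ and $k$ with $C'\sqrt{n}\,\log n\le k\le n$, there exists a set $\mathcal{E}\subseteq[n]\times[n]$ with $$|\mathcal{E}|\ \ge\ c\,\frac{k^2}{n(\log n)^{\alpha}}$$ (i.e., $|\mathcal{E}|=\widetilde{\Omega}(k^2/n)$) such that any two permutations $\pi,\pi'\in\mathbb{S}_n$ with the same $k$-profile coincide in their restriction to $\mathcal{E}$; that is, for every $(a,b)\in\mathcal{E}$, $\pi(a)=b\iff\pi'(a)=b$.
   Context: $\mathbb{S}_n$ is the set of permutations of $[n]=\{1,\dots,n\}$. For $\pi\in\mathbb{S}_n$ and $\tau\in\mathbb{S}_k$ with $k\le n$, $\#\tau(\pi)$ denotes the number of sets $S=\{s_1<\dots<s_k\}\subseteq[n]$ such that for all $i,j\in[k]$: $\pi(s_i)<\pi(s_j)\iff\tau(i)<\tau(j)$. The $k$-profile of $\pi$ is the vector $(\#\tau(\pi))_{\tau\in\mathbb{S}_k}$. A permutation is identified with the point set $\{(i,\pi(i)):i\in[n]\}\subseteq[n]\times[n]$. *)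

(* Defs.v *)
From HB Require Import structures.
From mathcomp Require Import all_boot all_fingroup.
Set Implicit Arguments.
Unset Strict Implicit.
Unset Printing Implicit Defensive.

(* [n] is represented by 'I_n = {0, ..., n-1}, and a permutation of [n] by an
   element of 'S_n. *)

(* S = {s_0 < ... < s_(k-1)}, and pi restricted to S is ordered as tau; s is
   the (unique) increasing enumeration of S, so that #|S| = k is implied. *)
Definition occurrence (n k : nat) (tau : 'S_k) (pi : 'S_n)
    (S : {set 'I_n}) : bool :=
  [exists s : {ffun 'I_k -> 'I_n},
    [&& [forall i : 'I_k, forall j : 'I_k, (i < j) ==> (s i < s j)],
        S == [set s i | i : 'I_k]
      & [forall i : 'I_k, forall j : 'I_k,
           (pi (s i) < pi (s j)) == (tau i < tau j)]]].

Definition pattern_count (n k : nat) (tau : 'S_k) (pi : 'S_n) : nat :=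
  #|[set S : {set 'I_n} | occurrence tau pi S]|.

Definition profile (n k : nat) (pi : 'S_n) : {ffun 'S_k -> nat} :=
  [ffun tau : 'S_k => pattern_count tau pi].

(* Main.v *)
Require Import Defs.
From HB Require Import structures.
From mathcomp Require Import all_boot all_order all_algebra all_fingroup.
From mathcomp Require Import reals exp.
From mathcomp Require Import ring lra zify.
Set Implicit Arguments.
Unset Strict Implicit.
Unset Printing Implicit Defensive.
Import Order.TTheory GRing.Theory Num.Theory.

(** The profile determines the whole first value of the permutation, so the
    first column of the grid, which has n >= k ^ 2 / n points, serves as the
    set E.

    Call an inversion of pi a pair x < y with pi y < pi x, and let
    [lehmer pi x] be the number of inversions whose left end is x.  The first
    entry of this Lehmer code is the first value itself ([lehmer0]).  The other
    entries do not have to be recovered; it is enough to damp them.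

    A function of a k-set S that depends only on the pattern of pi on S has the
    same sum over all k-sets for two permutations with equal profiles
    ([profile_sum]).  Take the function which adds, over the inversions (x, y)
    inside S, the binomial coefficient of the rank of x in S over i.  Its sum
    counts the inversions together with i positions left of x and with a k-set
    containing these i + 2 positions, hence it is a fixed positive multiple of
    the sum over x of [lehmer pi x] times x choose i
    ([profile_lehmer_moment]).  Binomial coefficients span the polynomials, so
    the sum of [lehmer pi x * p(x)] is determined by the profile for every
    polynomial p of degree at most k - 2 ([sum_horner_eq0]).

    It remains to find such a p with p(0) = 1 and |p(x)| <= 1 / n ^ 2 for
    x = 1, ..., n - 1: equality of the weighted sums then gives that the first
    entries of the two Lehmer codes differ by at most
    (n - 1) * n * (1 / n ^ 2) < 1, so they are equal
    ([profile_first_value]).  A Chebyshev polynomial of degree d about sqrt n,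
    with its argument moved affinely so that 1, ..., n falls into [-1, 1] and 0
    falls on 1 + 1 / n, is at most 1 in absolute value at 1, ..., n but at least
    1 + d ^ 2 / n >= 2 at 0.  Normalized and raised to a power of order log n,
    it becomes the required p ([damping_poly]), and its degree is of order
    sqrt n * log n. *)

Local Open Scope nat_scope.

(** * Ranks and the pattern of a permutation on a set *)

(** Both coordinates of a pattern are ranks of this kind: positions are ranks
    for [val], values are ranks for the permutation. *)
Definition rank_in (T : finType) (v : T -> nat) (A : {set T}) (x : T) : nat :=
  #|[set z in A | v z < v x]|.

Lemma rank_in_lt (T : finType) (v : T -> nat) (A : {set T}) (x : T) :
  x \in A -> rank_in v A x < #|A|.
Proof.
move=> xA; apply: proper_card; apply/properP; split.
  by apply/subsetP=> z; rewrite inE => /andP[].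
by exists x => //; rewrite inE ltnn andbF.
Qed.

Lemma ltn_rank_in (T : finType) (v : T -> nat) (A : {set T}) (x y : T) :
  x \in A -> (rank_in v A x < rank_in v A y) = (v x < v y).
Proof.
move=> xA; case: (ltnP (v x) (v y)) => vxy.
  apply: proper_card; apply/properP; split.
    by apply/subsetP=> z; rewrite !inE => /andP[-> /ltn_trans ->].
  by exists x; rewrite !inE xA ?vxy // ltnn.
apply/negbTE; rewrite -leqNgt; apply: subset_leq_card.
by apply/subsetP=> z; rewrite !inE => /andP[-> /leq_trans ->].
Qed.

Lemma rank_in_inj (T : finType) (v : T -> nat) (A : {set T}) :
  injective v -> {in A &, injective (rank_in v A)}.
Proof.
move=> v_inj x y xA yA rxy; apply: v_inj; apply/eqP.
have := ltn_rank_in v x yA; have := ltn_rank_in v y xA; rewrite rxy ltnn.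
by case: ltngtP.
Qed.

Lemma increasing_lt n k (s : 'I_k -> 'I_n) :
  (forall i j : 'I_k, i < j -> s i < s j) ->
  forall i j, (s i < s j) = (i < j).
Proof.
move=> s_mono i j.
case: (ltngtP i j) => [/s_mono -> // | /s_mono ltji | /val_inj ->].
  by apply/negbTE; rewrite -leqNgt ltnW.
by rewrite ltnn.
Qed.

Lemma increasing_inj n k (s : 'I_k -> 'I_n) :
  (forall i j : 'I_k, i < j -> s i < s j) -> injective s.
Proof.
move=> s_mono i j eqs; apply: val_inj.
by case: (ltngtP i j) => // /s_mono; rewrite eqs ltnn.
Qed.

Lemma card_ord_lt k (r : 'I_k) : #|[set j : 'I_k | j < r]| = r.
Proof.
have winj : injective (widen_ord (ltnW (ltn_ord r))).
  by move=> i j /(congr1 val) /= /val_inj.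
rewrite -[RHS]card_ord -(card_imset _ winj).
apply: eq_card => j; rewrite inE; apply/idP/imsetP => [ltjr | [i _ ->]].
  by exists (Ordinal ltjr) => //; apply: val_inj.
exact: (ltn_ord i).
Qed.

Lemma rank_in_mono n k (s : 'I_k -> 'I_n) (r : 'I_k) :
  (forall i j : 'I_k, i < j -> s i < s j) ->
  rank_in val (s @: 'I_k) (s r) = r.
Proof.
move=> s_mono.
have s_lt := increasing_lt s_mono; have s_inj := increasing_inj s_mono.
rewrite -[RHS]card_ord_lt -(card_imset _ s_inj); apply: eq_card => z.
rewrite inE; apply/andP/imsetP => [[/imsetP[i _ ->]] | [i]].
  by rewrite /= s_lt => ltir; exists i; rewrite // inE.
by rewrite inE => ltir ->; rewrite imset_f //= s_lt.
Qed.

Lemma perm_rank_in k (tau : 'S_k) (i : 'I_k) :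
  rank_in (fun j => tau j : nat) setT i = tau i.
Proof.
rewrite -[RHS]card_ord_lt -(card_preimset _ (@perm_inj _ tau)).
by apply: eq_card => j; rewrite !inE.
Qed.

Lemma occurrenceP n k (tau : 'S_k) (pi : 'S_n) (S : {set 'I_n}) :
  reflect (exists s : {ffun 'I_k -> 'I_n},
    [/\ forall i j : 'I_k, i < j -> s i < s j,
        S = [set s i | i : 'I_k]
      & forall i j : 'I_k, (pi (s i) < pi (s j)) = (tau i < tau j)])
  (occurrence tau pi S).
Proof.
apply: (iffP existsP) => -[s].
  case/and3P=> /'forall_forallP h1 /eqP h2 /'forall_'forall_eqP h3.
  by exists s; split=> // i j; apply/implyP.
move=> [h1 h2 h3]; exists s; apply/and3P; split; last 1 first.
- by apply/'forall_'forall_eqP.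
- by apply/'forall_forallP => i j; apply/implyP/h1.
- exact/eqP.
Qed.

(** The rank of s i in S is i, so S determines its increasing enumeration s;
    tau i is then the number of j with pi (s j) < pi (s i). *)
Lemma occurrence_uniq n k (tau tau' : 'S_k) (pi : 'S_n) (S : {set 'I_n}) :
  occurrence tau pi S -> occurrence tau' pi S -> tau = tau'.
Proof.
move=> /occurrenceP[s [s_mono SE s_tau]] /occurrenceP[s' [s'_mono SE' s'_tau]].
have eqs i : s' i = s i.
  have : s i \in S by rewrite SE imset_f.
  rewrite SE' => /imsetP[j _ eqij]; rewrite eqij; congr (s' _); apply: val_inj.
  by rewrite /= -(rank_in_mono i s_mono) -(rank_in_mono j s'_mono) -SE -SE' eqij.
apply/permP => i; apply: val_inj; rewrite /= -!perm_rank_in.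
by apply: eq_card => j; rewrite !inE /= -s_tau -s'_tau !eqs.
Qed.

Lemma occurrence_exists n k (pi : 'S_n) (S : {set 'I_n}) :
  #|S| = k -> exists tau : 'S_k, occurrence tau pi S.
Proof.
move=> cardS.
have enumS (v : 'I_n -> nat) : injective v ->
    forall i : 'I_k, exists x, x \in S /\ rank_in v S x = i.
  move=> v_inj i.
  (* [inord] needs a successor bound; the value k is never taken on S *)
  pose f x : 'I_k.+1 := inord (rank_in v S x).
  have fE x : x \in S -> f x = rank_in v S x :> nat.
    by move=> /(rank_in_lt v); rewrite cardS => lt; rewrite inordK // ltnW.
  have f_inj : {in S &, injective f}.
    move=> x y xS yS /(congr1 val); rewrite /= !fE //.
    exact: rank_in_inj.
  have fS : f @: S = [set j : 'I_k.+1 | j < k].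
    apply/eqP; rewrite eqEcard card_in_imset // cardS (card_ord_lt (@ord_max k)).
    rewrite leqnn andbT; apply/subsetP => _ /imsetP[x xS ->].
    by rewrite inE fE // -[X in _ < X]cardS rank_in_lt.
  have : widen_ord (leqnSn k) i \in f @: S by rewrite fS inE /=.
  by case/imsetP=> x xS /(congr1 val) /= ->; exists x; rewrite fE.
have [s sP] := fin_all_exists (enumS val val_inj).
have sS i : s i \in S by case: (sP i).
have sr i : rank_in val S (s i) = i by case: (sP i).
have s_inj : injective s.
  by move=> i j eqij; apply: val_inj; rewrite /= -!sr eqij.
have [t tP] : exists t : 'I_k -> 'I_k,
    forall i, t i = rank_in (fun x => pi x : nat) S (s i) :> nat.
  apply: (fin_all_exists (P := fun i (ti : 'I_k) =>
    ti = rank_in (fun x => pi x : nat) S (s i) :> nat)) => i.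
  have := rank_in_lt (fun x => pi x : nat) (sS i); rewrite cardS => lt.
  by exists (Ordinal lt).
have t_inj : injective t.
  move=> i j /(congr1 val); rewrite /= !tP => /rank_in_inj eqt; apply: s_inj.
  by apply: eqt => // x y /val_inj/perm_inj.
exists (perm t_inj); apply/occurrenceP; exists (finfun s); split.
- by move=> i j; rewrite !ffunE -(ltn_rank_in val (s j) (sS i)) !sr.
- apply/esym/eqP; rewrite eqEcard card_imset; last first.
    by move=> i j; rewrite !ffunE => /s_inj.
  rewrite card_ord cardS leqnn andbT.
  by apply/subsetP => _ /imsetP[i _ ->]; rewrite ffunE.
- by move=> i j; rewrite !ffunE !permE !tP ltn_rank_in.
Qed.

(** Each k-set carries exactly one pattern, so a pattern-determined sum over the
    k-sets can be regrouped by patterns. *)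
Lemma profile_sum n k (g : 'S_k -> nat) (pi : 'S_n) (G : {set 'I_n} -> nat) :
  (forall tau S, occurrence tau pi S -> G S = g tau) ->
  \sum_(S : {set 'I_n} | #|S| == k) G S =
  \sum_tau profile k pi tau * g tau.
Proof.
move=> GE.
transitivity (\sum_(tau : 'S_k) \sum_(S | occurrence tau pi S) G S);
  last first.
  apply: eq_bigr => tau _; rewrite ffunE /pattern_count -sum_nat_const.
  by rewrite [RHS]big_mkcond [LHS]big_mkcond; apply: eq_bigr => S _; rewrite inE;
    case: ifP => // /GE.
rewrite (exchange_big_dep (fun S : {set 'I_n} => #|S| == k)) /=.
  apply: eq_bigr => S /eqP /(occurrence_exists pi) [tau occ].
  rewrite (bigD1 tau) //= big1 ?addn0 // => tau' /andP[occ' /eqP []].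
  exact: occurrence_uniq occ' occ.
move=> tau S _ /occurrenceP[s [s_mono -> _]]; rewrite card_imset ?card_ord //.
exact: increasing_inj s_mono.
Qed.

(** * Moments of the Lehmer code *)

Definition inversion n (pi : 'S_n) (x y : 'I_n) := (x < y) && (pi y < pi x).

(** The rank of x in S and the inversions inside S can be read off the pattern on
    S, which makes the left-hand side a function of the profile. *)
Lemma profile_inversion_sum n k i (pi : 'S_n) :
  \sum_(S : {set 'I_n} | #|S| == k)
    \sum_(x in S) \sum_(y in S | inversion pi x y) 'C(rank_in val S x, i) =
  \sum_tau profile k pi tau *
    \sum_(r < k) \sum_(s < k | inversion tau r s) 'C(r, i).
Proof.
apply: profile_sum => tau S /occurrenceP[s [s_mono -> s_tau]].
have s_lt := increasing_lt s_mono; have s_inj := increasing_inj s_mono.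
rewrite big_imset /=; last by move=> ? ? _ _ /s_inj.
apply: eq_bigr => r _; rewrite rank_in_mono // big_mkcondr /=.
rewrite big_imset /=; last by move=> ? ? _ _ /s_inj.
rewrite [RHS]big_mkcond; apply: eq_bigr => t _.
by rewrite /inversion s_lt s_tau.
Qed.

Lemma card_supersets (T : finType) (A : {set T}) k : #|A| <= k ->
  #|[set S : {set T} | A \subset S & #|S| == k]| = 'C(#|T| - #|A|, k - #|A|).
Proof.
move=> leAk; rewrite -(cardsC A) addKn -cards_draws.
have inj : {in [set B : {set T} | B \subset ~: A & #|B| == k - #|A|] &,
  injective (setU A)}.
  move=> B B'; rewrite !inE => /andP[dB _] /andP[dB' _].
  move/(congr1 (fun C => C :\: A)).
  rewrite !setDUl !setDv !set0U !setDE.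
  by move/setIidPl: dB => ->; move/setIidPl: dB' => ->.
rewrite -(card_in_imset inj); apply: eq_card => S; rewrite inE.
apply/andP/imsetP => [[sAS /eqP cS] | [B]].
  exists (S :\: A); last by rewrite -[LHS](setID _ A) (setIidPr sAS).
  by rewrite inE cardsD (setIidPr sAS) cS eqxx andbT setDE subsetIr.
rewrite inE => /andP[dB /eqP cB] ->; split; first exact: subsetUl.
rewrite cardsU cB (_ : A :&: B = set0) ?cards0 ?subn0 ?subnKC //.
by apply/eqP; rewrite setI_eq0 disjoint_sym disjoints_subset.
Qed.

(** Double counting of the pairs (I, S) where I consists of i positions left of x
    and S is a k-set containing I, x and y: since I, x and y are i + 2 distinct
    positions, the number of choices of S is the same for every I. *)
Lemma sum_bin_rank_in n k i (x y : 'I_n) : i.+2 <= k -> x < y ->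
  \sum_(S : {set 'I_n} | [&& #|S| == k, x \in S & y \in S])
    'C(rank_in val S x, i) = 'C(x, i) * 'C(n - i.+2, k - i.+2).
Proof.
move=> leik ltxy.
pose below : {set 'I_n} := [set z : 'I_n | z < x].
have binE S : 'C(rank_in val S x, i) =
    \sum_(I : {set 'I_n} | (I \subset below) && (#|I| == i)) (I \subset S).
  rewrite -cards_draws -sum1dep_card [LHS]big_mkcond [RHS]big_mkcond.
  apply: eq_bigr => I _.
  have -> : [set z in S | val z < val x] = below :&: S.
    by apply/setP => z; rewrite !inE andbC.
  by rewrite subsetI; do 3 case: (_ \subset _) || case: (_ == _).
under eq_bigr do rewrite binE.
rewrite exchange_big /= -[in RHS](card_ord_lt x) -cards_draws -sum1dep_card.
rewrite big_distrl /=; apply: eq_bigr => I /andP[sIx /eqP cI]; rewrite mul1n.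
have xI : x \notin I.
  by apply/negP => /(subsetP sIx); rewrite inE ltnn.
have yI : y \notin x |: I.
  rewrite !inE negb_or -val_eqE /= gtn_eqF //=.
  by apply/negP => /(subsetP sIx); rewrite inE ltnNge ltnW.
have cA : #|y |: (x |: I)| = i.+2 by rewrite !cardsU1 yI xI cI.
have := @card_supersets _ (y |: (x |: I)) k; rewrite cA card_ord => <- //.
rewrite -big_mkcondr /=.
rewrite sum1dep_card; apply: eq_card => S; rewrite !inE.
rewrite !subUset !sub1set.
by do 4 case: (_ \in _) || case: (_ == _) || case: (_ \subset _).
Qed.

Definition lehmer n (pi : 'S_n) (x : 'I_n) := #|[set y | inversion pi x y]|.

Lemma inversion_sum_lehmer n k i (pi : 'S_n) : i.+2 <= k ->
  \sum_(S : {set 'I_n} | #|S| == k)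
    \sum_(x in S) \sum_(y in S | inversion pi x y) 'C(rank_in val S x, i) =
  (\sum_x lehmer pi x * 'C(x, i)) * 'C(n - i.+2, k - i.+2).
Proof.
move=> leik; rewrite (exchange_big_dep xpredT) //= big_distrl /=.
apply: eq_bigr => x _.
rewrite (exchange_big_dep (inversion pi x)) /=; last by move=> S y _ /andP[].
rewrite -mulnA /lehmer -sum_nat_const big_set /=.
apply: eq_bigr => y inv_xy; have [ltxy _] := andP inv_xy.
rewrite -(sum_bin_rank_in leik ltxy).
by apply: eq_bigl => S; rewrite inv_xy andbT andbA.
Qed.

(** The bounds on i and k make the common factor of [inversion_sum_lehmer]
    positive, so that it can be cancelled. *)
Lemma profile_lehmer_moment n k i (pi pi' : 'S_n) :
  i.+2 <= k -> k <= n -> profile k pi = profile k pi' ->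
  \sum_x lehmer pi x * 'C(x, i) = \sum_x lehmer pi' x * 'C(x, i).
Proof.
move=> leik lekn eqp; apply/eqP.
rewrite -(@eqn_pmul2r 'C(n - i.+2, k - i.+2)) ?bin_gt0 ?leq_sub2r //.
by rewrite -!inversion_sum_lehmer // !profile_inversion_sum eqp.
Qed.

Lemma lehmer0 n (pi : 'S_n.+1) : lehmer pi ord0 = pi ord0.
Proof.
rewrite -[RHS]card_ord_lt -(card_preimset _ (@perm_inj _ pi)).
apply: eq_card => y; rewrite !inE /inversion.
by case: (posnP y) => //= y0; rewrite (_ : y = ord0) ?ltnn //; apply: val_inj.
Qed.

Local Open Scope ring_scope.

(** * From binomial moments to polynomial weights *)

Lemma mul_bin_self x i : (x * 'C(x, i) = i.+1 * 'C(x, i.+1) + i * 'C(x, i))%N.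
Proof.
rewrite mul_bin_left -mulnDl; case: (leqP i x) => [/subnK -> // | ltxi].
by rewrite bin_small ?muln0.
Qed.

(** By [mul_bin_self], multiplying a binomial coefficient by x leaves the span of
    the binomial coefficients and raises the degree by one; induction on j gives
    the weights x ^ j * 'C(x, i) with i + j < d, and i = 0 gives the monomials. *)
Lemma sum_horner_eq0 (R : comNzRingType) n d (D : 'I_n -> R) :
  (forall i, (i < d)%N -> \sum_x D x * 'C(x, i)%:R = 0) ->
  forall p : {poly R}, (size p <= d)%N -> \sum_x D x * p.[x%:R] = 0.
Proof.
move=> D0.
have Dbin j i : (i + j < d)%N -> \sum_x D x * (x%:R ^+ j * 'C(x, i)%:R) = 0.
  elim: j i => [|j IHj] i ltd.
    by under eq_bigr do rewrite mul1r; apply: D0; rewrite -[i]addn0.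
  have h1 : \sum_x D x * (x%:R ^+ j * 'C(x, i.+1)%:R) = 0 by apply: IHj; lia.
  have h2 : \sum_x D x * (x%:R ^+ j * 'C(x, i)%:R) = 0 by apply: IHj; lia.
  transitivity (i.+1%:R * (\sum_x D x * (x%:R ^+ j * 'C(x, i.+1)%:R)) +
    i%:R * (\sum_x D x * (x%:R ^+ j * 'C(x, i)%:R)));
    last by rewrite h1 h2 !mulr0 addr0.
  rewrite !mulr_sumr -big_split /=; apply: eq_bigr => x _.
  rewrite exprSr -mulrA -natrM mul_bin_self natrD !natrM; ring.
move=> p sp; under eq_bigr do rewrite horner_coef mulr_sumr.
rewrite exchange_big big1 //= => j _.
have D0j := Dbin j 0%N (leq_trans (ltn_ord j) sp).
transitivity (p`_j * (\sum_x D x * (x%:R ^+ j * 'C(x, 0)%:R)));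
  last by rewrite D0j mulr0.
by rewrite mulr_sumr; apply: eq_bigr => x _; rewrite bin0; ring.
Qed.

(** * Chebyshev polynomials and damping polynomials *)

(** The pair (T_d, U_(d-1)) of Chebyshev polynomials of the first and second
    kind, by the addition formulas for cos and sin.  Carrying both makes the
    bounds inside and outside [-1, 1] immediate inductions. *)
Fixpoint chebyshev (R : comNzRingType) d : {poly R} * {poly R} :=
  if d is d'.+1 then
    let: (T, U) := chebyshev R d' in ('X * T + ('X ^+ 2 - 1) * U, 'X * U + T)
  else (1, 0).

Lemma size_chebyshev (R : realFieldType) d :
  (size (chebyshev R d).1 <= d.+1)%N && (size (chebyshev R d).2 <= d)%N.
Proof.
elim: d => [|d] /=; first by rewrite size_poly1 size_poly0.
case: (chebyshev R d) => T U /= /andP[sT sU].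
have mulX (p : {poly R}) e : (size p <= e)%N -> (size ('X * p)%R <= e.+1)%N.
  move=> sp; apply: leq_trans (size_polyMleq _ _) _.
  by rewrite size_polyX addSn.
have X2 : (size ('X ^+ 2 - 1 : {poly R})%R <= 3)%N.
  by rewrite size_XnsubC.
apply/andP; split; apply: leq_trans (size_polyD _ _) _; rewrite geq_max.
  rewrite mulX //=; apply: leq_trans (size_polyMleq _ _) _.
  by rewrite -subn1 leq_subLR; apply: leq_trans (leq_add X2 sU) _.
by rewrite mulX.
Qed.

(** This is cos ^ 2 + sin ^ 2 = 1 when u is a cosine. *)
Lemma chebyshev_pell (R : realFieldType) d (u : R) :
  (chebyshev R d).1.[u] ^+ 2 + (1 - u ^+ 2) * (chebyshev R d).2.[u] ^+ 2 = 1.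
Proof.
elim: d => [|d] /=; first by rewrite hornerC horner0; ring.
case: (chebyshev R d) => T U /= IHd; rewrite -[RHS]IHd.
by rewrite !(hornerD, hornerN, hornerM, hornerXn, hornerX, hornerC); ring.
Qed.

Lemma chebyshev_le1 (R : realFieldType) d (u : R) :
  `|u| <= 1 -> `|(chebyshev R d).1.[u]| <= 1.
Proof.
move=> u1; rewrite -(@ler_sqr _ _ 1) ?nnegrE // expr1n real_normK ?num_real //.
rewrite -[leRHS](chebyshev_pell d u) lerDl mulr_ge0 ?sqr_ge0 // subr_ge0.
by rewrite -real_normK ?num_real // expr_le1.
Qed.

(** Just outside [-1, 1], T_d already doubles at distance 1 / d ^ 2; this
    quadratic gain is why degree sqrt n can separate 0 from 1, ..., n. *)
Lemma chebyshev_growth (R : realFieldType) d (delta : R) : 0 <= delta ->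
  1 + d%:R ^+ 2 * delta <= (chebyshev R d).1.[1 + delta] /\
  d%:R <= (chebyshev R d).2.[1 + delta].
Proof.
move=> d0; elim: d => [|d] /=; first by rewrite hornerC horner0; split; lra.
case: (chebyshev R d) => T U /= [hT hU]; rewrite -[d.+1]addn1 natrD.
rewrite !(hornerD, hornerN, hornerM, hornerXn, hornerX, hornerC).
have d1 : 0 <= d%:R :> R := ler0n _ _.
split; nra.
Qed.

Lemma half_damping_poly (R : realFieldType) n d : (0 < n)%N -> (n <= d ^ 2)%N ->
  exists q : {poly R}, [/\ (size q <= d.+1)%N, q.[0] = 1 &
    forall x, (0 < x <= n)%N -> `|q.[x%:R]| <= 2^-1].
Proof.
move=> n0 nd; pose T := (chebyshev R d).1; pose delta : R := n%:R^-1.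
have delta0 : 0 <= delta by rewrite invr_ge0 ler0n.
have nR : 0 < n%:R :> R by rewrite ltr0n.
have T2 : 2 <= T.[1 + delta].
  have [+ _] := chebyshev_growth d delta0; apply: le_trans.
  suff : 1 <= d%:R ^+ 2 * delta by lra.
  by rewrite /delta ler_pdivlMr // mul1r -natrX ler_nat.
(* maps 0 to 1 + 1 / n, 1 to 1 and n to 1 / n *)
pose L : {poly R} := (1 + delta)%:P - delta *: 'X.
have sL : (size L <= 2)%N.
  rewrite (leq_trans (size_polyD _ _)) // geq_max size_polyN.
  rewrite (leq_trans (size_polyC_leq1 _)) //=.
  by rewrite (leq_trans (size_scale_leq _ _)) // size_polyX.
have LE x : L.[x] = 1 + delta - delta * x by rewrite /L !hornerE.
exists (T.[1 + delta]^-1 *: (T \Po L)); split.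
- apply: leq_trans (size_scale_leq _ _) _.
  apply: leq_trans (size_comp_poly_leq _ _) _; rewrite ltnS.
  have /andP[sT _] := size_chebyshev R d; rewrite -/T in sT.
  have : ((size T).-1 * (size L).-1 <= d * 1)%N by apply: leq_mul; lia.
  by rewrite muln1.
- by rewrite hornerZ horner_comp LE mulr0 subr0 mulVf //; lra.
move=> x /andP[x0 xn]; rewrite hornerZ horner_comp LE normrM.
have -> : 1 + delta - delta * x%:R = 1 + delta * (1 - x%:R) by ring.
have x1 : 1 <= x%:R :> R by rewrite ler1n.
have dx : delta * x%:R <= 1 by rewrite mulrC /delta ler_pdivrMr // mul1r ler_nat.
have Tx : `|T.[1 + delta * (1 - x%:R)]| <= 1.
  apply: chebyshev_le1; rewrite ler_norml; apply/andP; split; nra.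
have Ti : `|T.[1 + delta]^-1| <= 2^-1.
  by rewrite normfV lef_pV2 ?posrE ?normr_gt0 ?ger0_norm //; lra.
by rewrite -[leRHS]mulr1 ler_pM.
Qed.

Lemma damping_poly (R : realFieldType) n d m : (0 < n)%N -> (n <= d ^ 2)%N ->
  exists p : {poly R}, [/\ (size p <= (d * m).+1)%N, p.[0] = 1 &
    forall x, (0 < x <= n)%N -> `|p.[x%:R]| <= 2^-1 ^+ m].
Proof.
move=> n0 nd; have [q [sq q0 qx]] := half_damping_poly R n0 nd.
exists (q ^+ m); split.
- apply: leq_trans (size_poly_exp_leq _ _) _; rewrite ltnS.
  by apply: leq_mul; rewrite // -subn1 leq_subLR add1n.
- by rewrite horner_exp q0 expr1n.
- by move=> x /qx qx2; rewrite horner_exp normrX lerXn2r ?nnegrE ?invr_ge0.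
Qed.

(** * The first value *)

(** With D the difference of the Lehmer codes, the sum of D x * p(x) vanishes; its
    term at x = 0 is D 0 and the others add up to less than 1 in absolute
    value. *)
Lemma profile_first_value n k d m (pi pi' : 'S_n.+1) :
  (n.+1 <= d ^ 2)%N -> (n.+1 ^ 2 <= 2 ^ m)%N -> (d * m + 2 <= k)%N ->
  (k <= n.+1)%N -> profile k pi = profile k pi' -> pi ord0 = pi' ord0.
Proof.
move=> nd n2m dmk kn eqp.
have [p [sp p0 px]] := damping_poly rat m (ltn0Sn n) nd.
pose D x : rat := (lehmer pi x)%:R - (lehmer pi' x)%:R.
have D0 : \sum_x D x * p.[x%:R] = 0.
  apply: (@sum_horner_eq0 _ _ k.-1) => [i ltik|]; last first.
    by apply: leq_trans sp _; lia.
  have leik : (i.+2 <= k)%N by lia.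
  have := congr1 (fun a => a%:R : rat) (profile_lehmer_moment leik kn eqp).
  rewrite !natr_sum => eqm; under eq_bigr do rewrite mulrBl -!natrM.
  by rewrite sumrB eqm ?subrr //; lia.
have Dn x : `|D x| <= n.+1%:R.
  have l0 (s : 'S_n.+1) : (0 <= ((lehmer s x)%:R : rat) <= n.+1%:R).
    by rewrite ler0n ler_nat -[X in (_ <= X)%N]card_ord max_card.
  have := l0 pi; have := l0 pi'; rewrite /D => /andP[? ?] /andP[? ?].
  by rewrite ler_norml; apply/andP; split; lra.
have Dlt : `|D ord0| < 1.
  move: D0; rewrite big_ord_recl p0 mulr1 => /eqP; rewrite addr_eq0 => /eqP ->.
  rewrite normrN; apply: le_lt_trans (ler_norm_sum _ _ _) _.
  have : \sum_(i < n) `|D (lift ord0 i) * p.[(lift ord0 i)%:R]| <=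
         \sum_(i < n) (n.+1%:R^-1 : rat).
    apply: ler_sum => i _; rewrite normrM.
    apply: (@le_trans _ _ (n.+1%:R * 2^-1 ^+ m)).
      by apply: ler_pM => //; apply: px; have := ltn_ord i; rewrite lift0; lia.
    rewrite exprVn ler_pdivrMr ?exprn_gt0 // ler_pdivlMl ?ltr0n //.
    by rewrite -expr2 -!natrX ler_nat.
  move/le_lt_trans; apply; rewrite sumr_const card_ord -[_ *+ n]mulr_natl.
  by rewrite ltr_pdivrMr ?ltr0n // mul1r ltr_nat.
apply: val_inj; rewrite /= -!lehmer0; move: Dlt; rewrite /D ltr_norml => /andP[].
by case: (ssrnat.ltngtP (lehmer pi ord0) (lehmer pi' ord0)) => //;
  rewrite -(ler_nat rat) -addn1 natrD => *; exfalso; clear eqp; lra.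
Qed.

(** With t the integral part of the binary logarithm of n, the choices
    d <= sqrt n + 1 <= 2 * sqrt n and m = 2 * (t + 1) <= 4 * t give
    d * m + 2 <= 8 * sqrt n * t + 2 <= 10 * sqrt n * t, and t <= ln n / ln 2;
    this is where the constant 10 / ln 2 comes from. *)
Lemma damping_parameters (R : realType) n k : (2 <= n)%N ->
  10 / ln 2 * Num.sqrt n%:R * ln n%:R <= k%:R :> R ->
  exists d m, [/\ (n <= d ^ 2)%N, (n ^ 2 <= 2 ^ m)%N & (d * m + 2 <= k)%N].
Proof.
move=> n2 nk; pose t := trunc_log 2 n.
have /andP[t_le t_gt] : (2 ^ t <= n < 2 ^ t.+1)%N by apply: trunc_log_bounds; lia.
have t1 : (1 <= t)%N by apply: trunc_log_max.
pose s : R := Num.sqrt n%:R.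
have s1 : 1 <= s by rewrite -sqrtr1 ler_wsqrtr // ler1n; lia.
have s2 : s ^+ 2 = n%:R by rewrite sqr_sqrtr ?ler0n.
pose d := (Num.truncn s).+1.
have /andP[d_le d_gt] := @truncn_itv _ s (le_trans ler01 s1).
have nd : (n <= d ^ 2)%N.
  by rewrite -(ler_nat R) natrX -s2 lerXn2r ?nnegrE ?ler0n ?ltW //; lra.
exists d, (2 * t.+1)%N; split=> //.
  by rewrite mulnC expnM leq_exp2r // ltnW.
have ds : d%:R <= 2 * s by rewrite /d -addn1 natrD; lra.
have ln2 : 0 < ln 2 :> R by rewrite ln_gt0 // ltr1n.
have tn : t%:R * ln 2 <= ln n%:R :> R.
  rewrite mulrC mulr_natr -lnXn // ler_ln ?posrE ?exprn_gt0 ?ltr0n //.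
    by rewrite -natrX ler_nat.
  by lia.
have tR : 1 <= t%:R :> R by rewrite ler1n.
have sk : 10 * s * t%:R <= k%:R.
  apply: le_trans nk; rewrite -/s.
  rewrite (_ : 10 / ln 2 * s * ln n%:R = 10 * s * (ln n%:R / ln 2));
    last by ring.
  by apply: ler_wpM2l; rewrite ?ler_pdivlMr //; lra.
rewrite -(ler_nat R); apply: le_trans sk.
rewrite natrD !natrM -[t.+1]addn1 natrD.
have d0 : 0 <= d%:R :> R by rewrite ler0n.
have : d%:R * (2 * (t%:R + 1)) <= 2 * s * (4 * t%:R) by apply: ler_pM; lra.
nra.
Qed.

Theorem theorem4 (R : realType) :
  exists c C' alpha : R,
    [/\ 0 < c, 0 < C', 0 <= alpha &
      forall n k : nat, (2 <= n)%N ->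
        C' * Num.sqrt n%:R * ln n%:R <= k%:R -> (k <= n)%N ->
        exists E : {set 'I_n * 'I_n},
          c * (k%:R ^+ 2 / (n%:R * (ln n%:R `^ alpha))) <= #|E|%:R /\
          forall pi pi' : 'S_n, profile k pi = profile k pi' ->
            forall a b : 'I_n, (a, b) \in E -> (pi a = b <-> pi' a = b)].
Proof.
exists 1, (10 / ln 2), 0; split=> //.
  by rewrite divr_gt0 // ln_gt0 // ltr1n.
case=> [//|n] k n2 nk kn; exists (setX [set ord0] [set: 'I_n.+1]); split.
  rewrite cardsX cards1 cardsT card_ord mul1n powRr0 mulr1 mul1r.
  by rewrite ler_pdivrMr ?ltr0n // -expr2 -!natrX ler_nat leq_exp2r.
have [d [m [nd n2m dmk]]] := damping_parameters n2 nk.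
move=> pi pi' eqp a b; rewrite !inE andbT /= => /eqP ->.
by rewrite (profile_first_value nd n2m dmk kn eqp).
Qed.
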